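(* Let $p>3$ be a prime and let $m,n\in\mathbb Z_p$ with $mn\not\equiv 0\pmod p$. Then $$\sum_{x=0}^{p-1}\Big(\frac{x^3+mx+n}{p}\Big)\equiv\begin{cases} -(-3m)^{\frac{p-1}4}\displaystyle\sum_{k=0}^{p-1}\binom{-\frac 1{12}}k\binom{-\frac 5{12}}k\Big(\frac{4m^3+27n^2}{4m^3}\Big)^k\pmod p&\text{if }4\mid p-1,\\[2mm] \frac{2m}{9n}\Big(\frac{-3m}{p}\Big)(-3m)^{\frac{p+1}4}\displaystyle\sum_{k=0}^{p-1}\binom{-\frac 1{12}}k\binom{-\frac 5{12}}k\Big(\frac{4m^3+27n^2}{4m^3}\Big)^k\pmod p&\text{if }4\mid p-3,\end{cases}$$ and also $$\sum_{x=0}^{p-1}\Big(\frac{x^3+mx+n}{p}\Big)\equiv\begin{cases} (-1)^{\frac{p+1}2}\big(\frac n2\big)^{\frac{p-1}6}\displaystyle\sum_{k=0}^{p-1}\binom{-\frac 1{12}}k\binom{-\frac 7{12}}k\Big(\frac{4m^3+27n^2}{27n^2}\Big)^k\pmod p&\text{if }3\mid p-1,\\[2mm] (-1)^{\frac{p+1}2}\frac 3m\big(\frac 2n\big)^{\frac{p-5}6}\displaystyle\sum_{k=0}^{p-1}\binom{-\frac 1{12}}k\binom{-\frac 7{12}}k\Big(\frac{4m^3+27n^2}{27n^2}\Big)^k\pmod p&\text{if }3\mid p-2.\end{cases}$$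
   Context: For a prime $p$, $\mathbb Z_p$ denotes the set of rational numbers whose denominator is coprime to $p$; for $a,b\in\mathbb Z_p$, $a\equiv b\pmod p$ means $(a-b)/p\in\mathbb Z_p$. For rational $a$ and integer $k\ge0$, $\binom ak=a(a-1)\cdots(a-k+1)/k!$. $\big(\frac ap\big)$ is the Legendre symbol, extended to $a\in\mathbb Z_p$ via the residue of $a$ modulo $p$. *)

(* Defs.v *)
From mathcomp Require Import all_boot all_order all_algebra.

Set Implicit Arguments.
Unset Strict Implicit.
Unset Printing Implicit Defensive.

Import GRing.Theory.
Local Open Scope ring_scope.

(* The ring Z_p of p-integral rationals; [denq a] is the positive denominator
   of [a] in lowest terms. *)
Definition pintegral (p : nat) (a : rat) : bool := coprime p `|denq a|%N.

(* a = b (mod p) in Z_p. *)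
Definition eqmodp (p : nat) (a b : rat) : bool :=
  pintegral p ((a - b) / p%:R).

Definition binomq (a : rat) (k : nat) : rat :=
  (\prod_(i < k) (a - i%:R)) / (k`!)%:R.

(* For p prime and a in Z_p, [ratr a : 'F_p] (numerator over denominator,
   computed in 'F_p) is the residue of a modulo p. *)
Definition legendre (p : nat) (a : rat) : int :=
  let r : 'F_p := ratr a in
  if r == 0 then 0 else if [exists y : 'F_p, y ^+ 2 == r] then 1 else -1.

(* Main.v *)
(* Modulo p, with h = (p-1)/2, Euler's criterion turns the character sum into
   the sum over x of (x^3+mx+n)^h, that is, minus the coefficient of x^(p-1) in
   (x^3+mx+n)^h (the Hasse invariant).  Up to a monomial in m and n, this is a
   polynomial in u = -27n^2/(4m^3), and also in v = 1/u; by a two-term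
   recurrence on multinomial coefficients it satisfies, modulo p, the
   hypergeometric equation with (a, b; c) = (1/12, 5/12; 1/2), respectively
   (1/12, 7/12; 2/3).  Since c = a + b, the substitution t = 1 - u leads to the
   equation with c = 1, whose polynomial solutions of degree < p are determined
   by their value at t = 0.  That value is read off the singular cubic
   x^3 - 3x + 2 = (x-1)^2 (x+2), for which u = 1. *)
Require Import Defs.
From mathcomp Require Import all_boot all_order all_algebra.
From mathcomp Require Import cyclic finfield.
From mathcomp Require Import zify ring.
Import GRing.Theory Num.Theory.

Local Open Scope ring_scope.

(** * Polynomial solutions of the hypergeometric equation in characteristic p *)

Section Hypergeometric.
Variable (F : fieldType) (p : nat).
Hypothesis (charF : p \in [pchar F]).

Definition hyprec (a b c : F) (P : {poly F}) : Prop :=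
  forall k, (k.+1%:R * (k%:R + c)) * P`_k.+1 = (k%:R + a) * (k%:R + b) * P`_k.

(** Gauss's hypergeometric operator. Substituting 1 - X is a chain-rule computation in this form,
    whereas [hyprec] is the form that determines coefficients. *)
Definition hypode (a b c : F) (P : {poly F}) : {poly F} :=
  'X * (1 - 'X) * P^`()^`() + (c%:P - (a + b + 1)%:P * 'X) * P^`() - (a * b)%:P * P.

Lemma coef_hypode a b c P k :
  (hypode a b c P)`_k =
    (k.+1%:R * (k%:R + c)) * P`_k.+1 - (k%:R + a) * (k%:R + b) * P`_k.
Proof.
have -> : hypode a b c P = 'X * P^`()^`() - 'X * ('X * P^`()^`()) + c%:P * P^`()
   - (a + b + 1)%:P * ('X * P^`()) - (a * b)%:P * P by rewrite /hypode; ring.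
rewrite !(coefB, coefD, coefCM, coefXM, coef_deriv).
case: k => [|[|k]] /=; rewrite ?(coef_deriv, coefXM) /=; ring.
Qed.

Lemma hypode0 a b c P : hypode a b c P = 0 <-> hyprec a b c P.
Proof.
split=> [H k|H].
  by apply/eqP; rewrite -subr_eq0 -coef_hypode H coef0.
by apply/polyP=> k; rewrite coef_hypode H subrr coef0.
Qed.

(** The substitution exchanges the singular points 0 and 1 and replaces c by a + b + 1 - c, which is
    1 here. *)
Lemma hyprec_comp a b P :
  hyprec a b (a + b) P -> hyprec a b 1 (P \Po (1 - 'X)).
Proof.
move/hypode0 => H; apply/hypode0.
have := congr1 (fun q => q \Po (1 - 'X)) H.
have d1 : (1 - 'X)^`() = - 1 :> {poly F} by rewrite derivB -polyC1 derivC derivX sub0r.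
rewrite /hypode !deriv_comp derivM deriv_comp d1 derivN -{2}polyC1 derivC.
rewrite !(comp_polyB, comp_polyD, comp_polyM, comp_polyC, comp_polyX) -?polyC1.
rewrite !(polyCD, polyCM).
move: (P \Po _) (P^`() \Po _) (P^`()^`() \Po _) => A B C E.
by rewrite -[RHS]E; ring.
Qed.

(** At (-a, -b) the signs cancel and this is (a)_k (b)_k / k!^2, the k-th coefficient of 2F1(a, b;
    1). *)
Definition hypcoef (a b : F) (k : nat) : F :=
  (\prod_(i < k) (a - i%:R)) / (k`!)%:R * ((\prod_(i < k) (b - i%:R)) / (k`!)%:R).

Lemma natr_pchar_neq0 (k : nat) : (0 < k < p)%N -> k%:R != 0 :> F.
Proof.
case/andP=> k0 kp; rewrite -(dvdn_pcharf charF).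
by apply/negP => /(dvdn_leq k0); rewrite leqNgt kp.
Qed.

Lemma fact_pchar_neq0 (k : nat) : (k < p)%N -> k`!%:R != 0 :> F.
Proof.
elim: k => [|k IH] kp; first by rewrite oner_neq0.
by rewrite factS natrM mulf_neq0 ?IH ?(natr_pchar_neq0 k.+1) //; lia.
Qed.

(** After the substitution the recurrence reads (k + 1)^2 G_(k+1) = (k + a)(k + b) G_k. Since k + 1
    is invertible below p, every coefficient follows from G_0 = P(1). *)
Lemma hyprec_sum a b (P : {poly F}) u : (size P <= p)%N -> hyprec a b (a + b) P ->
  P.[u] = P.[1] * \sum_(k < p) hypcoef (- a) (- b) k * (1 - u) ^+ k.
Proof.
move=> sP /hyprec_comp; set G := _ \Po _ => H.
have sG : (size G <= p)%N.
  rewrite size_comp_poly2 // -opprB size_polyN.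
  by rewrite -[1]/(1%:P) size_XsubC.
have GC k : (k < p)%N -> G`_k = P.[1] * hypcoef (- a) (- b) k.
  elim: k => [|k IH] kp.
    rewrite /hypcoef !big_ord0 -horner_coef0 horner_comp !hornerE subr0.
    by rewrite fact0 invr1 /= !mulr1.
  have k0 : k.+1%:R != 0 :> F by apply: natr_pchar_neq0.
  have kf : k`!%:R != 0 :> F by apply: fact_pchar_neq0; lia.
  apply: (mulfI k0); apply: (mulfI k0).
  have := H k; rewrite IH; last by lia.
  rewrite -natr1 mulrA => ->.
  rewrite /hypcoef !big_ord_recr /= factS natrM -natr1.
  move: k0; rewrite -natr1 => k0.
  by field; rewrite kf k0.
have -> : P.[u] = G.[1 - u].
  by rewrite horner_comp; congr _.[_]; rewrite !hornerE; ring.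
rewrite (horner_coef_wide _ sG) big_distrr /=.
by apply: eq_bigr => k _; rewrite GC // -mulrA.
Qed.

End Hypergeometric.

(** The q - 1 nonzero elements are distinct (q - 1)-th roots of unity; that many of them in a field
    force a primitive one. *)
Lemma finField_generator (F : finFieldType) :
  exists z : F, (#|F|.-1).-primitive_root z.
Proof.
have F1 : (0 < #|F|.-1)%N by rewrite -subn1 subn_gt0 finNzRing_gt1.
pose s := [seq x <- enum F | x != 0].
have /hasP[z _ zP] : has (#|F|.-1).-primitive_root s; last by exists z.
apply: has_prim_root => //.
- apply/allP=> x; rewrite mem_filter => /andP[x0 _].
  rewrite unity_rootE; apply/eqP/(mulfI x0).
  by rewrite -exprS mulr1 prednK ?expf_card //; apply/card_gt0P; exists 0.
- by rewrite filter_uniq ?enum_uniq.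
- rewrite size_filter -sum1_count big_enum_cond /= sum1_card -(cardC1 (0 : F)).
  by apply: subset_leq_card; apply/subsetP=> x; rewrite !inE.
Qed.

(** * Multinomial coefficients of the Hasse invariant *)

(* Coefficient of m^(2N-3i) n^(2i-N) x^(2N) in (x^3+mx+n)^N; it vanishes for
   2i < N because the second binomial coefficient does. *)
Definition hasse_coef (N i : nat) : nat :=
  if (3 * i <= 2 * N)%N then ('C(N, i) * 'C(N - i, 2 * N - 3 * i))%N else 0.

(** The coefficient is the multinomial N! / (i! (2N - 3i)! (2i - N)!), and this is the ratio of
    neighbours cleared of denominators. Subtraction is taken in [R], where vanishing factors settle
    the ends of the range. *)
Lemma hasse_coef_rec (R : comNzRingType) N i :
  (hasse_coef N i.+1)%:R * (i.+1%:R * (2 * i%:R + 1 - N%:R) * (2 * i%:R + 2 - N%:R)) =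
  (hasse_coef N i)%:R *
    ((2 * N%:R - 3 * i%:R) * (2 * N%:R - 3 * i%:R - 1) * (2 * N%:R - 3 * i%:R - 2)) :> R.
Proof.
have [Ni|iN] := leqP (3 * i.+1) (2 * N); last first.
  rewrite {1}/hasse_coef leqNgt iN mul0r.
  have [Ni|?] := leqP (3 * i) (2 * N); last by rewrite /hasse_coef leqNgt ifN ?mul0r //; lia.
  (* At the upper end 2N - 3i is 0, 1 or 2, so one of the three factors on the right is zero. *)
  have [d [d3 Nd]] : exists d, (d < 3 /\ 2 * N = 3 * i + d)%N by exists (2 * N - 3 * i)%N; lia.
  have -> : 2 * N%:R = 3 * i%:R + d%:R :> R by rewrite -!natrM -natrD Nd.
  by case: d d3 {Nd} => [|[|[|//]]] _; ring.
have [Ni2|iN2] := leqP N (2 * i); last first.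
  have -> : hasse_coef N i = 0%N.
    by rewrite /hasse_coef; case: ifP => // _; rewrite ['C(N - i, _)]bin_small ?muln0 //; lia.
  have [iN3|iN3] := ltnP (2 * i.+1) N.
    have -> : hasse_coef N i.+1 = 0%N.
      by rewrite /hasse_coef; case: ifP => // _; rewrite ['C(N - i.+1, _)]bin_small ?muln0 //; lia.
    by rewrite !mul0r.
  (* At the lower end a factor on the left is zero. *)
  have [->|->] : N = (2 * i + 1)%N \/ N = (2 * i + 2)%N by lia.
    by rewrite natrD natrM; ring.
  by rewrite natrD natrM; ring.
(* The parts of the multinomial are (i, j + 3, l) at index i and (i + 1, j, l + 2) at index i +
   1. *)
pose j := (2 * N - 3 * i.+1)%N; pose l := (2 * i - N)%N.
have NE : N = (i + (j + 3 + l))%N by rewrite /j /l; lia.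
have E : (hasse_coef N i.+1 * (i.+1 * l.+1 * l.+2) = hasse_coef N i * (j.+3 * j.+2 * j.+1))%N.
  rewrite /hasse_coef Ni ifT; last by lia.
  have -> : (2 * N - 3 * i.+1 = j)%N by [].
  have -> : (2 * N - 3 * i = j.+3)%N by rewrite /j; lia.
  have := mul_bin_left N i; have := mul_bin_diag (N - i) j.
  have := mul_bin_left (N - i) j.+1; have := mul_bin_left (N - i) j.+2.
  have -> : ((N - i).-1 = N - i.+1)%N by lia.
  have -> : (N - i - j.+1 = l.+2)%N by rewrite {1}NE; lia.
  have -> : (N - i - j.+2 = l.+1)%N by rewrite {1}NE; lia.
  move: 'C(_, _) 'C(_, _) 'C(_, _) 'C(_, _) 'C(_, _) 'C(_, _).
  move=> c1 c2 c3 c4 c5 c6 e1 e2 e3 e4.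
  rewrite [LHS](_ : _ = (i.+1 * c2) * c3 * (l.+1 * l.+2))%N; last by ring.
  rewrite e4 [LHS](_ : _ = c1 * ((N - i) * c3) * (l.+1 * l.+2))%N; last by ring.
  rewrite e3 [LHS](_ : _ = c1 * j.+1 * (l.+2 * c4) * l.+1)%N; last by ring.
  rewrite -e2 [LHS](_ : _ = c1 * j.+1 * j.+2 * (l.+1 * c5))%N; last by ring.
  by rewrite -e1; ring.
have e1 : 2 * i%:R = N%:R + l%:R :> R.
  by rewrite -natrM -natrD; congr _%:R; rewrite /l; lia.
have e2 : 2 * N%:R = 3 * i%:R + 3 + j%:R :> R.
  by rewrite -!natrM -!natrD; congr _%:R; rewrite /j; lia.
rewrite e1 e2 (_ : _ * _ = (hasse_coef N i.+1 * (i.+1 * l.+1 * l.+2))%N%:R); last by ring.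
by rewrite E; ring.
Qed.

(* Hypotheses about field elements are of no use to [lia] and slow it down. *)
Ltac arith := repeat match goal with H : context [GRing.zero] |- _ => clear H end; lia.

(** * Power sums and the character sum of a cubic over F_p *)

Section PrimeField.
Variable p : nat.
Hypotheses (p_prime : prime p) (p_gt3 : (3 < p)%N).
Local Notation F := 'F_p.
Local Notation h := (p.-1)./2.

Lemma double_half_pred_prime : (2 * h)%N = p.-1.
Proof.
have := even_prime p_prime; have := odd_double_half p.-1; rewrite -mul2n; arith.
Qed.

Lemma Fp_expp1 (x : F) : x != 0 -> x ^+ p.-1 = 1.
Proof.
move=> x0; apply/(mulfI x0); rewrite mulr1 -exprS prednK ?prime_gt0 //.
by have := expf_card x; rewrite card_Fp.
Qed.

Lemma Fp_generator : exists z : F, (p.-1).-primitive_root z.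
Proof. by have [z] := finField_generator F; rewrite card_Fp // => ?; exists z. Qed.

(** Substituting x -> z x with z a generator multiplies the sum by z^k, which differs from 1 unless
    p - 1 divides k. The bound leaves k = 0, with sum p = 0 because 0^0 = 1, and k = p - 1, with p -
    1 terms equal to 1. *)
Lemma Fp_power_sum k : (k < 2 * p.-1)%N ->
  \sum_(x : F) x ^+ k = if k == p.-1 then -1 else 0.
Proof.
move=> kp; have p1 : (0 < p.-1)%N by arith.
case: eqVneq => [->|kp1].
  rewrite (bigD1 0) //= expr0n gtn_eqF // add0r.
  under eq_bigr => x x0 do rewrite Fp_expp1 //.
  rewrite sumr_const cardC1 card_Fp //; apply/eqP; rewrite -addr_eq0.
  by rewrite natr1 prednK ?prime_gt0 // pchar_Fp_0.
have [k0|k0] := posnP k.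
  rewrite k0; under eq_bigr do rewrite expr0.
  by rewrite sumr_const card_Fp // pchar_Fp_0.
have [z zP] := Fp_generator.
have zk : z ^+ k != 1.
  rewrite -(prim_order_dvd zP); apply/negP => /dvdnP[c ck].
  by move: kp kp1 k0; rewrite ck; case: c {ck} => [|[|c]]; nia.
have z0 : z != 0.
  apply: contraNneq zk => z0; have := prim_expr_order zP.
  by rewrite z0 expr0n gtn_eqF // => /eqP; rewrite eq_sym oner_eq0.
apply: (mulfI (x := z ^+ k - 1)); first by rewrite subr_eq0.
rewrite mulr0 mulrBl mul1r big_distrr /=; apply/eqP; rewrite subr_eq0; apply/eqP.
rewrite [RHS](reindex_inj (mulfI z0)).
by apply: eq_bigr => x _; rewrite exprMn.
Qed.

Let charF : p \in [pchar F] := pchar_Fp p_prime.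
Let h2 := double_half_pred_prime.

Lemma natr_Fp_neq0_2_3 : (2 != 0 :> F) * (3 != 0 :> F).
Proof. by split; apply: (natr_pchar_neq0 _ _ charF); arith. Qed.
Let F2 := natr_Fp_neq0_2_3.1.
Let F3 := natr_Fp_neq0_2_3.2.
Let F4 : 4 != 0 :> F.
Proof. by rewrite (natrM _ 2 2) mulf_neq0. Qed.
Let F12 : 12 != 0 :> F.
Proof. by rewrite (natrM _ 3 4) mulf_neq0. Qed.
Let F27 : 27 != 0 :> F.
Proof. by rewrite (natrM _ 3 9) (natrM _ 3 3) !mulf_neq0. Qed.
Let F16 : 16 != 0 :> F.
Proof. by rewrite (natrM _ 4 4) mulf_neq0. Qed.

Lemma half_pred_prime_natr : 2 * h%:R = -1 :> F.
Proof.
rewrite -natrM h2; apply/eqP.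
by rewrite -addr_eq0 natr1 prednK ?prime_gt0 // pchar_Fp_0.
Qed.

Definition cubic_sum (m n : F) : F := \sum_(x : F) (x ^+ 3 + m * x + n) ^+ h.

(** The indices for which neither natural subtraction [2 * i - h] nor [2 * h - 3 * i] is truncated,
    so that both are the true exponents. *)
Definition hasse_coef_range i := (h <= 2 * i)%N && (3 * i <= 2 * h)%N.

Lemma hasse_coef_out i : ~~ hasse_coef_range i -> hasse_coef h i = 0%N.
Proof.
rewrite /hasse_coef_range /hasse_coef; case: ifP => // i3; rewrite andbT => i2.
by rewrite ['C(h - i, _)]bin_small ?muln0 //; arith.
Qed.

Lemma hasse_coef0 : hasse_coef h 0 = 0%N.
Proof. by apply: hasse_coef_out; rewrite /hasse_coef_range; arith. Qed.

(** In the trinomial expansion the exponent 3i + j of x is at most 3h < 2(p - 1), so only the terms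
    with 3i + j = p - 1 = 2h survive summation over x, each with factor -1. *)
Lemma cubic_sumE m n : cubic_sum m n =
  - \sum_(i < h.+1) (hasse_coef h i)%:R * (m ^+ (2 * h - 3 * i) * n ^+ (2 * i - h)).
Proof.
have E x : (x ^+ 3 + m * x + n) ^+ h =
    \sum_(i < h.+1) \sum_(j < (h - i).+1)
      (n ^+ (h - i - j) * m ^+ j *+ 'C(h - i, j) *+ 'C(h, i)) * x ^+ (3 * i + j).
  rewrite (_ : _ + _ = (n + m * x) + x ^+ 3); last by ring.
  rewrite exprDn; apply: eq_bigr => i _.
  rewrite exprDn big_distrl -sumrMnl; apply: eq_bigr => j _ /=.
  by rewrite exprMn exprD exprM; ring.
rewrite /cubic_sum; under eq_bigr => x _ do rewrite E.
rewrite exchange_big -sumrN; apply: eq_bigr => i _ /=.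
rewrite exchange_big /=.
under eq_bigr => j _.
  rewrite -big_distrr /= Fp_power_sum //; last by have := ltn_ord i; have := ltn_ord j; arith.
  over.
have ih := ltn_ord i.
have [ir|] := boolP (hasse_coef_range i); last first.
  move=> ir; rewrite (hasse_coef_out _ ir) mul0r oppr0; apply: big1 => j _.
  case: eqP => [E'|]; last by rewrite mulr0.
  by move: ir; rewrite /hasse_coef_range; have := ltn_ord j; arith.
have jP : (2 * h - 3 * i < (h - i).+1)%N by move: ir; rewrite /hasse_coef_range; arith.
rewrite (bigD1 (Ordinal jP)) //= big1 => [|j jj]; last first.
  case: eqP => [E'|]; last by rewrite mulr0.
  by case/eqP: jj; apply/val_inj => /=; arith.
have /andP[r1 r2] := ir.
rewrite ifT; last by arith.
rewrite /hasse_coef r2 natrM (_ : h - i - (2 * h - 3 * i) = 2 * i - h)%N; last by arith.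
by ring.
Qed.

(** For x different from 1 the square factor (x - 1)^2 becomes 1 under the power h. The full sum of
    (x + 2)^h is a translated power sum, hence zero, and the missing term x = 1 is 3^h. *)
Lemma cubic_sum_singular : cubic_sum (-3) 2 = - 3 ^+ h.
Proof.
rewrite /cubic_sum (bigD1 1) //= (_ : 1 ^+ 3 + _ + _ = 0); last by ring.
rewrite expr0n gtn_eqF ?add0r; last by arith.
transitivity (\sum_(x : F | x != 1) (x + 2) ^+ h).
  apply: eq_bigr => x x1.
  rewrite (_ : _ + _ = (x - 1) ^+ 2 * (x + 2)); last by ring.
  by rewrite exprMn -exprM h2 Fp_expp1 ?mul1r // subr_eq0.
have : \sum_(x : F) (x + 2) ^+ h = 0.
  have := Fp_power_sum h; rewrite (reindex_inj (addIr 2)) /= => ->; last by arith.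
  by rewrite ifN //; arith.
rewrite (bigD1 1) //= => /eqP; rewrite addrC addr_eq0 => /eqP ->.
by congr (- _ ^+ _); ring.
Qed.

(** Modulo p, h = -1/2, so the factor 2h - 3i - 2 becomes -3(i + 1) and cancels i + 1 on the other
    side. *)
Lemma hasse_coef_rec_Fp i : (4 * i%:R + 3) * (4 * i%:R + 5) * (hasse_coef h i.+1)%:R =
  - 12 * (3 * i%:R + 1) * (3 * i%:R + 2) * (hasse_coef h i)%:R :> F.
Proof.
have [ih|hi] := ltnP i h; last first.
  by rewrite !hasse_coef_out ?mulr0 // /hasse_coef_range; arith.
have i0 : i.+1%:R != 0 :> F by apply: (natr_pchar_neq0 _ _ charF); arith.
apply: (mulfI i0); have := hasse_coef_rec F h i; rewrite half_pred_prime_natr.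
have -> : h%:R = - 1 / 2 :> F.
  by apply: (mulfI F2); rewrite half_pred_prime_natr; field.
move=> E.
transitivity (4 * ((hasse_coef h i.+1)%:R *
    (i.+1%:R * (2 * i%:R + 1 - -1 / 2) * (2 * i%:R + 2 - -1 / 2))) : F).
  by field.
by rewrite E; ring.
Qed.

(** * Generating polynomials and their hypergeometric equations *)

(* [s k] is the exponent of x^3 in the monomial that contributes u^k (or v^k);
   modulo p it is k - 1/4, respectively -1/3 - k. *)
Definition hasse_poly (l : F) (s : nat -> nat) : {poly F} :=
  \poly_(k < p) ((hasse_coef h (s k))%:R * l ^+ k).

(** With i = k - 1/4 the factors become 16 (k + 1/2)(k + 1) and 9 (k + 1/12)(k + 5/12); [- 4 / 27]
    absorbs the constants. The second alternative covers truncation of [s] to 0, where the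
    coefficient vanishes. The condition at [p.-1] makes the recurrence hold where the polynomial is
    cut off. *)
Lemma hyprec_hasse_poly_incr s :
  (forall k, (s k.+1 = (s k).+1 /\ 4 * (s k)%:R = 4 * k%:R - 1 :> F) \/
    (s k = 0 /\ s k.+1 = 0)%N) ->
  hasse_coef h (s p.-1) = 0%N ->
  hyprec F (1 / 12) (5 / 12) (1 / 12 + 5 / 12) (hasse_poly (- 4 / 27) s).
Proof.
move=> sP sp k; rewrite /hasse_poly !coef_poly.
case: (ltngtP k p.-1) => kp.
- rewrite !ifT; try arith.
  case: (sP k) => [[-> E]|[-> ->]]; last by rewrite hasse_coef0 !mul0r !mulr0.
  have := hasse_coef_rec_Fp (s k).
  rewrite (_ : 3 * (s k)%:R = 3 / 4 * (4 * (s k)%:R)); last by field.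
  rewrite E exprS -[k.+1%:R]natr1 => {}E; move: (_ ^+ k) => L.
  transitivity ((4 * k%:R - 1 + 3) * (4 * k%:R - 1 + 5) * (hasse_coef h (s k).+1)%:R *
                  (- 4 / 27 * L / 16) : F).
    by field; rewrite ?F3 ?F4 ?F12 ?F16 ?F27.
  rewrite E.
  by field; rewrite ?F3 ?F4 ?F12 ?F16 ?F27.
- by rewrite !ifN ?mulr0 //; arith.
- by rewrite kp sp mul0r ifN ?if_same ?mulr0 //; arith.
Qed.

(** Here the recurrence runs backwards: at i = [s k.+1] = -k - 4/3 the factors become 16 (k +
    1/12)(k + 7/12) and 9 (k + 1)(k + 2/3), with the roles of the two sides exchanged. *)
Lemma hyprec_hasse_poly_decr s :
  (forall k, (s k = (s k.+1).+1 /\ 3 * (s k)%:R = - 3 * k%:R - 1 :> F) \/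
    (s k = 0 /\ s k.+1 = 0)%N) ->
  hasse_coef h (s p.-1) = 0%N ->
  hyprec F (1 / 12) (7 / 12) (1 / 12 + 7 / 12) (hasse_poly (- 27 / 4) s).
Proof.
move=> sP sp k; rewrite /hasse_poly !coef_poly.
case: (ltngtP k p.-1) => kp.
- rewrite !ifT; try arith.
  case: (sP k) => [[ss E]|[-> ->]]; last by rewrite hasse_coef0 !mul0r !mulr0.
  have := hasse_coef_rec_Fp (s k.+1).
  have {}E : 3 * (s k.+1)%:R = - 3 * k%:R - 4 :> F.
    by move: E; rewrite ss -[(s k.+1).+1%:R]natr1 mulrDr => /(canRL (addrK _)) ->; ring.
  rewrite (_ : 4 * (s k.+1)%:R = 4 / 3 * (3 * (s k.+1)%:R)); last by field.
  rewrite E exprS -ss -[k.+1%:R]natr1 => {}E; move: (_ ^+ k) => L.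
  transitivity (- 12 * (-3 * k%:R - 4 + 1) * (-3 * k%:R - 4 + 2) * (hasse_coef h (s k.+1))%:R *
                  (L / 16) : F).
    by field; rewrite ?F3 ?F4 ?F12 ?F16 ?F27.
  rewrite -E.
  by field; rewrite ?F3 ?F4 ?F12 ?F16 ?F27.
- by rewrite !ifN ?mulr0 //; arith.
- by rewrite kp sp mul0r ifN ?if_same ?mulr0 //; arith.
Qed.

Lemma hasse_coef_sum_widen (G : nat -> F) N : (2 * h < 3 * N)%N ->
  \sum_(0 <= i < N) (hasse_coef h i)%:R * G i = \sum_(i < h.+1) (hasse_coef h i)%:R * G i.
Proof.
have widen M M' : (2 * h < 3 * M)%N -> (M <= M')%N ->
    \sum_(0 <= i < M') (hasse_coef h i)%:R * G i = \sum_(0 <= i < M) (hasse_coef h i)%:R * G i.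
  move=> hM MM; rewrite (big_cat_nat (leq0n M) MM) /=.
  rewrite [X in _ + X]big_nat_cond [X in _ + X]big1 ?addr0 // => i /andP[/andP[Mi _] _].
  by rewrite hasse_coef_out ?mul0r // /hasse_coef_range; arith.
move=> hN; rewrite -(big_mkord xpredT (fun i => (hasse_coef h i)%:R * G i)).
case: (leqP N h.+1) => [Nh|/ltnW hN1]; first by rewrite [RHS](widen N).
by rewrite [LHS](widen h.+1) //; arith.
Qed.

(* The scalar [l] is -4/27 or -27/4, so that l * u = n^2/m^3, respectively
   l * v = m^3/n^2. *)
Lemma cubic_sum_hasse_poly (s : nat -> nat) (l m n u c : F) :
  (forall G : nat -> F, \sum_(k < p) (hasse_coef h (s k))%:R * G (s k) =
                        \sum_(i < h.+1) (hasse_coef h i)%:R * G i) ->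
  (forall k, (k < p)%N -> hasse_coef_range (s k) ->
     m ^+ (2 * h - 3 * s k) * n ^+ (2 * s k - h) = c * (l * u) ^+ k) ->
  cubic_sum m n = - c * (hasse_poly l s).[u].
Proof.
move=> sG sE; rewrite cubic_sumE //.
rewrite -(sG (fun i => m ^+ (2 * h - 3 * i) * n ^+ (2 * i - h))).
rewrite horner_poly mulNr big_distrr /=; congr (- _); apply: eq_bigr => k _.
have [r|r] := boolP (hasse_coef_range (s k)); last by rewrite hasse_coef_out // !mul0r mulr0.
by rewrite sE // exprMn; ring.
Qed.

(** The singular cubic with (m, n) = (-3, 2) has u = 1, so its known sum supplies the value at 1
    that [hyprec_sum] leaves open: c(-3, 2) P(1) = 3^h. *)
Lemma cubic_sum_hyp (s : nat -> nat) (l a b : F) (c u : F -> F -> F) :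
  hyprec F a b (a + b) (hasse_poly l s) ->
  (forall G : nat -> F, \sum_(k < p) (hasse_coef h (s k))%:R * G (s k) =
                        \sum_(i < h.+1) (hasse_coef h i)%:R * G i) ->
  (forall m n k, m != 0 -> n != 0 -> (k < p)%N -> hasse_coef_range (s k) ->
     m ^+ (2 * h - 3 * s k) * n ^+ (2 * s k - h) = c m n * (l * u m n) ^+ k) ->
  u (- 3) 2 = 1 ->
  forall m n, m != 0 -> n != 0 ->
  c (- 3) 2 * cubic_sum m n =
    - 3 ^+ h * c m n * \sum_(k < p) hypcoef F (- a) (- b) k * (1 - u m n) ^+ k.
Proof.
move=> rec sG sE u1 m n m0 n0.
have N3 : -3 != 0 :> F by rewrite oppr_eq0.
rewrite (cubic_sum_hasse_poly s l m n (u m n) (c m n)) //; last by move=> k; apply: sE.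
rewrite (hyprec_sum F p charF a b) ?size_poly //.
have := cubic_sum_singular.
rewrite (cubic_sum_hasse_poly s l (-3) 2 1 (c (-3) 2)) //; last by move=> k *; rewrite sE ?u1.
rewrite [X in X = _ -> _]mulNr => /eqP; rewrite eqr_opp => /eqP <-; ring.
Qed.

(** * Euler's criterion and the quadratic character of -3 *)

Lemma Fp_euler (r : F) : r != 0 ->
  r ^+ h = if [exists y : F, y ^+ 2 == r] then 1 else -1.
Proof.
move=> r0; have [z zP] := Fp_generator.
case: existsP => [[y /eqP yr]|nsq].
  by rewrite -yr -exprM h2 Fp_expp1 //; apply: contraNneq r0 => y0; rewrite -yr y0 expr0n.
(* If r = z^i and r^h = 1, then p - 1 = 2h divides i h, so i is even and r is a square. *)
have [[i /= ip] rz] := prim_rootP zP (Fp_expp1 r r0).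
have : r ^+ h ^+ 2 == 1 by rewrite -exprM mulnC h2 Fp_expp1.
rewrite sqrf_eq1 => /orP[|/eqP //]; rewrite rz -exprM -(prim_order_dvd zP).
rewrite -[X in (X %| _)%N]h2 dvdn_pmul2r; last by arith.
move=> /dvdnP[j ij]; case: nsq; exists (z ^+ j).
by rewrite rz /= ij exprM.
Qed.

(** A primitive cube root of unity w exists, and (2w + 1)^2 = 4(w^2 + w + 1) - 3 = -3. *)
Lemma Fp_minus3_power_1mod3 : (3 %| p - 1)%N -> (-3) ^+ h = 1 :> F.
Proof.
rewrite subn1 => /dvdnP[e pe]; rewrite Fp_euler ?oppr_eq0 // ifT //; apply/existsP.
have [z zP] := Fp_generator.
exists (2 * z ^+ e + 1).
have z3 : (z ^+ e - 1) * (z ^+ e ^+ 2 + z ^+ e + 1) = 0.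
  rewrite (_ : _ * _ = z ^+ e ^+ 3 - 1); last by ring.
  by rewrite -exprM -pe (prim_expr_order zP) subrr.
have /eqP := z3; rewrite mulf_eq0 subr_eq0 -(prim_order_dvd zP) pe => /orP[|/eqP E].
  by move/dvdnP => [c]; case: c => [|c]; arith.
rewrite -subr_eq0 (_ : _ - _ = 4 * (z ^+ e ^+ 2 + z ^+ e + 1)); last by ring.
by rewrite E mulr0.
Qed.

(** If y^2 = -3, then (y - 1)/2 is a cube root of unity. As 3 does not divide p - 1, Fermat makes it
    1, so y = 3 and 12 = 0. *)
Lemma Fp_minus3_power_2mod3 : (3 %| p - 2)%N -> (-3) ^+ h = - 1 :> F.
Proof.
move=> /dvdnP[e pe]; rewrite Fp_euler ?oppr_eq0 // ifN //.
apply/existsP => -[y /eqP y3].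
have w3 : ((y - 1) / 2) ^+ 3 = 1.
  transitivity ((y * y ^+ 2 - 3 * y ^+ 2 + 3 * y - 1) / 8).
    by field; rewrite F2 (natrM _ 2 4) mulf_neq0.
  by rewrite y3; field; rewrite (natrM _ 2 4) mulf_neq0.
have w0 : (y - 1) / 2 != 0 by apply/eqP => w0; move/eqP: w3; rewrite w0 expr0n eq_sym oner_eq0.
have := Fp_expp1 _ w0.
rewrite (_ : p.-1 = (3 * e).+1)%N; last by arith.
rewrite exprS exprM w3 expr1n mulr1 => /(canRL (divfK F2)) /(canRL (subrK 1)) y1.
case/eqP: F12; rewrite (_ : 12%:R = 3 ^+ 2 - (- 3)); last by ring.
by rewrite -y3 y1; ring.
Qed.

(** * Reindexing sums along [s] *)

Lemma sum_shift_add (f : nat -> F) g : (forall i, (i < g)%N -> f i = 0) ->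
  \sum_(k < p) f (k + g)%N = \sum_(0 <= i < p + g) f i.
Proof.
move=> f0; rewrite (big_cat_nat (leq0n g) (leq_addl _ _)) /=.
rewrite [X in X + _]big_nat [X in X + _]big1 => [|i /andP[_ ig]]; last exact: f0.
by rewrite add0r [in RHS](big_addn 0 (p + g) g) addnK big_mkord.
Qed.

(** Truncated subtraction sends every k < c to index 0, where [f] vanishes. *)
Lemma sum_shift_sub (f : nat -> F) c : f 0%N = 0 -> (c <= p)%N ->
  \sum_(k < p) f (k - c)%N = \sum_(0 <= i < p - c) f i.
Proof.
move=> f0 cp; rewrite -(big_mkord xpredT (fun k => f (k - c)%N)).
rewrite (big_cat_nat (leq0n c) cp) /= [X in X + _]big_nat [X in X + _]big1 => [|i /andP[_ ig]].
  rewrite add0r -{1}[c]add0n big_addn; apply: eq_bigr => i _.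
  by rewrite addnK.
by rewrite (_ : i - c = 0)%N //; arith.
Qed.

Lemma sum_reverse (f : nat -> F) K : f 0%N = 0 -> (K < p)%N ->
  \sum_(k < p) f (K - k)%N = \sum_(0 <= i < K.+1) f i.
Proof.
move=> f0 Kp; rewrite -(big_mkord xpredT (fun k => f (K - k)%N)).
rewrite (big_cat_nat (leq0n K.+1) Kp) /= [X in _ + X]big_nat [X in _ + X]big1 => [|i /andP[ig _]].
  rewrite addr0 [RHS]big_nat_rev /=; apply: eq_bigr => i _.
  by congr f; arith.
by rewrite (_ : K - i = 0)%N //; arith.
Qed.

Let N3 : -3 != 0 :> F.
Proof. by rewrite oppr_eq0. Qed.

Local Notation S a b u := (\sum_(k < p) hypcoef F (- (a)) (- (b)) k * u ^+ k).

Lemma p_pred_natr g r : (p = g + r)%N -> g%:R = - r%:R :> F.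
Proof. by move=> pe; apply/eqP; rewrite -addr_eq0 -natrD -pe pchar_Fp_0. Qed.

(** * The four congruences as identities in F_p *)

Lemma cubic_sum_1mod4 (m n : F) : m != 0 -> n != 0 -> (4 %| p - 1)%N ->
  cubic_sum m n = - (- 3 * m) ^+ ((p - 1) %/ 4) *
    S (1 / 12) (5 / 12) ((4 * m ^+ 3 + 27 * n ^+ 2) / (4 * m ^+ 3)).
Proof.
move=> m0 n0 /dvdnP[g pg]; rewrite pg mulnK //.
have pE : (p = 4 * g + 1)%N by arith.
have hE : (h = 2 * g)%N by arith.
(* Here g = -1/4 modulo p, and the monomial at k + g is m^(g - 3k) n^(2k). *)
have H := cubic_sum_hyp (addn^~ g) (- 4 / 27) (1 / 12) (5 / 12)
  (fun m _ => m ^+ g) (fun m n => - 27 * n ^+ 2 / (4 * m ^+ 3)).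
have {H} := H _ _ _ _ m n m0 n0.
rewrite (_ : 1 - _ = (4 * m ^+ 3 + 27 * n ^+ 2) / (4 * m ^+ 3)); last by field; rewrite m0.
move=> H; apply: (mulfI (x := (-3) ^+ g)); first by rewrite expf_neq0.
rewrite H {H}.
- rewrite hE exprM (_ : 3 ^+ 2 = (-3) * (-3)); last by ring.
  by rewrite !exprMn; ring.
- apply: hyprec_hasse_poly_incr => // [k|].
    left; split=> //; rewrite natrD mulrDr.
    by have := p_pred_natr _ _ pE; rewrite natrM => ->.
  by apply: hasse_coef_out; rewrite /hasse_coef_range; arith.
- move=> G; rewrite (sum_shift_add (fun i => (hasse_coef h i)%:R * G i)).
    by rewrite hasse_coef_sum_widen //; arith.
  by move=> i ig; rewrite hasse_coef_out ?mul0r // /hasse_coef_range; arith.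
- move=> {m0 n0} {}m {}n k m0 n0 _ r.
  have [r1 r2] : (2 * h - 3 * (k + g) = g - 3 * k /\ 2 * (k + g) - h = 2 * k)%N.
    by move: r; rewrite /hasse_coef_range; arith.
  have r3 : (3 * k <= g)%N by move: r; rewrite /hasse_coef_range; arith.
  rewrite r1 r2 -{2}(subnK r3) exprD !exprM.
  rewrite (_ : - 4 / 27 * _ = n ^+ 2 / m ^+ 3); last by field; rewrite ?F4 ?F27 m0.
  by rewrite expr_div_n; field; rewrite !expf_neq0.
- by field; rewrite oppr_eq0 (natrM _ 4 27) mulf_neq0.
Qed.

Lemma cubic_sum_3mod4 (m n : F) : m != 0 -> n != 0 -> (4 %| p - 3)%N ->
  cubic_sum m n = (2 * m) / (9 * n) * (- 3 * m) ^+ h * (- 3 * m) ^+ ((p + 1) %/ 4) *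
    S (1 / 12) (5 / 12) ((4 * m ^+ 3 + 27 * n ^+ 2) / (4 * m ^+ 3)).
Proof.
move=> m0 n0 /dvdnP[g pg].
have pE : (p = 4 * g + 3)%N by arith.
have -> : ((p + 1) %/ 4 = g + 1)%N by rewrite (_ : p + 1 = (g + 1) * 4)%N ?mulnK //; arith.
have hE : (h = 2 * g + 1)%N by arith.
(* Since 4(g + 1) = p + 1, -1/4 is -(g + 1) modulo p. The monomial is m^(7g + 5 - 3k) n^(2k - p),
   and n^p = n gives the denominator n. *)
have H := cubic_sum_hyp (subn^~ (g + 1)%N) (- 4 / 27) (1 / 12) (5 / 12)
  (fun m n => m ^+ (7 * g + 5) / n) (fun m n => - 27 * n ^+ 2 / (4 * m ^+ 3)).
have {H} := H _ _ _ _ m n m0 n0.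
rewrite (_ : 1 - _ = (4 * m ^+ 3 + 27 * n ^+ 2) / (4 * m ^+ 3)); last by field; rewrite m0.
have fermat (x : F) : x != 0 -> x ^+ (4 * g + 2) = 1.
  by move=> x0; rewrite (_ : 4 * g + 2 = p.-1)%N ?Fp_expp1 //; arith.
move=> H; apply: (mulfI (x := (-3) ^+ (7 * g + 5) / 2)).
  by rewrite mulf_neq0 ?invr_neq0 ?expf_neq0.
rewrite H {H}.
- rewrite hE.
  (* Fermat aligns the exponents: m^(7g + 5) = m^(3g + 3) and (-3)^(2g + 1) = (-3)^(10g + 5). *)
  have -> : m ^+ (7 * g + 5) = m ^+ (3 * g + 3) * m ^+ (4 * g + 2).
    by rewrite -exprD; congr (_ ^+ _); arith.
  rewrite fermat // mulr1.
  have -> : - 3 ^+ (2 * g + 1) = (-3) ^+ (2 * g + 1) :> F.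
    by rewrite [RHS]exprNn -signr_odd oddD oddM; ring.
  have -> : (-3) ^+ (2 * g + 1) = (-3) ^+ (2 * g + 1) * ((-3) ^+ (4 * g + 2)) ^+ 2 :> F.
    by rewrite fermat // expr1n mulr1.
  have e c d (x : F) : x ^+ (c * g + d) = x ^+ g ^+ c * x ^+ d by rewrite exprD mulnC exprM.
  rewrite !exprMn !(e 2 1)%N !(e 4 2)%N !(e 3 3)%N !(e 7 5)%N !exprD.
  by field; rewrite n0 (natrM _ 3 3) mulf_neq0.
- apply: hyprec_hasse_poly_incr => // [k|].
    have [kg|kg] := ltnP k (g + 1); [right|left]; split=> //; try by arith.
    have -> : (4 * (k - (g + 1))%:R = 4 * k%:R - (4 * g + 3)%N%:R - 1 :> F).
      by rewrite natrB // natrD [in RHS]natrD natrM; ring.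
    by rewrite -pE pchar_Fp_0 // subr0.
  by apply: hasse_coef_out; rewrite /hasse_coef_range; arith.
- move=> G; rewrite (sum_shift_sub (fun i => (hasse_coef h i)%:R * G i)); last 2 first.
    by rewrite hasse_coef0 mul0r.
    by arith.
  by rewrite hasse_coef_sum_widen //; arith.
- move=> {m0 n0} {}m {}n k m0 n0 _ r.
  rewrite (_ : - 4 / 27 * _ = n ^+ 2 / m ^+ 3); last by field; rewrite ?F4 ?F27 m0.
  (* This multiplication removes the negative exponents, so that natural-number arithmetic
     suffices. *)
  apply: (mulIf (x := m ^+ (3 * k) * n ^+ p)); first by rewrite mulf_neq0 ?expf_neq0.
  rewrite [LHS](_ : _ = m ^+ (2 * h - 3 * (k - (g + 1)) + 3 * k) *
                       n ^+ (2 * (k - (g + 1)) - h + p)); last first.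
    by rewrite [in RHS](exprD m _ (3 * k)) [in RHS](exprD n _ (p)) mulrACA.
  rewrite (_ : 2 * h - 3 * (k - (g + 1)) + 3 * k = 7 * g + 5)%N; last first.
    by move: r; rewrite /hasse_coef_range; arith.
  rewrite (_ : 2 * (k - (g + 1)) - h + p = 2 * k)%N; last first.
    by move: r; rewrite /hasse_coef_range; arith.
  rewrite (_ : n ^+ p = n); last first.
    by rewrite -[X in _ ^+ X](prednK (prime_gt0 p_prime)) exprS Fp_expp1 // mulr1.
  by rewrite expr_div_n !exprM; field; rewrite !expf_neq0 // n0.
- by field; rewrite oppr_eq0 (natrM _ 4 27) mulf_neq0.
Qed.

Lemma cubic_sum_1mod3 (m n : F) : m != 0 -> n != 0 -> (3 %| p - 1)%N ->
  cubic_sum m n = (-1) ^+ ((p + 1) %/ 2) * (n / 2) ^+ ((p - 1) %/ 6) *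
    S (1 / 12) (7 / 12) ((4 * m ^+ 3 + 27 * n ^+ 2) / (27 * n ^+ 2)).
Proof.
move=> m0 n0 p1.
have [e pE] : exists e, p = (6 * e + 1)%N by exists ((p - 1) %/ 6)%N; arith.
have -> : ((p - 1) %/ 6 = e)%N by arith.
have -> : ((p + 1) %/ 2 = h + 1)%N by arith.
have hE : (h = 3 * e)%N by clear p1; arith.
(* Here 2e = -1/3 modulo p, and the monomial at 2e - k is m^(3k) n^(e - 2k). *)
have H := cubic_sum_hyp (subn (2 * e)) (- 27 / 4) (1 / 12) (7 / 12)
  (fun _ n => n ^+ e) (fun m n => - 4 * m ^+ 3 / (27 * n ^+ 2)).
have {H} := H _ _ _ _ m n m0 n0.
rewrite (_ : 1 - _ = (4 * m ^+ 3 + 27 * n ^+ 2) / (27 * n ^+ 2)); last by field; rewrite n0.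
move=> H; apply: (mulfI (x := 2 ^+ e)); first by rewrite expf_neq0.
rewrite H {H}.
- have h3 : 3 ^+ h = (-1) ^+ h :> F.
    have := Fp_minus3_power_1mod3 p1; rewrite exprNn => /(canRL (signrMK _)).
    by rewrite mulr1.
  by rewrite h3 expr_div_n exprD expr1; field; rewrite expf_neq0.
- apply: hyprec_hasse_poly_decr => // [k|].
    have [kK|kK] := ltnP k (2 * e); [left|right]; split=> //; try by arith.
    rewrite natrB 1?ltnW // mulrBr -natrM mulnA.
    by rewrite (p_pred_natr _ _ pE); ring.
  by apply: hasse_coef_out; rewrite /hasse_coef_range; arith.
- move=> G; rewrite (sum_reverse (fun i => (hasse_coef h i)%:R * G i)); last 2 first.
    by rewrite hasse_coef0 mul0r.
    by arith.
  by rewrite hasse_coef_sum_widen //; arith.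
- move=> {m0 n0} {}m {}n k m0 n0 _ r.
  have [r1 r2] : (2 * h - 3 * (2 * e - k) = 3 * k /\ 2 * (2 * e - k) - h = e - 2 * k)%N.
    by move: r; rewrite /hasse_coef_range; arith.
  have r3 : (2 * k <= e)%N by move: r; rewrite /hasse_coef_range; arith.
  rewrite r1 r2 -[in RHS](subnK r3) exprD !exprM.
  rewrite (_ : - 27 / 4 * _ = m ^+ 3 / n ^+ 2); last by field; rewrite ?F4 ?F27 n0.
  by rewrite expr_div_n; field; rewrite !expf_neq0.
- by field; rewrite (natrM _ 4 27) mulf_neq0.
Qed.

Lemma cubic_sum_2mod3 (m n : F) : m != 0 -> n != 0 -> (3 %| p - 2)%N ->
  cubic_sum m n = (-1) ^+ ((p + 1) %/ 2) * (3 / m) * (2 / n) ^+ ((p - 5) %/ 6) *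
    S (1 / 12) (7 / 12) ((4 * m ^+ 3 + 27 * n ^+ 2) / (27 * n ^+ 2)).
Proof.
move=> m0 n0 p2.
have [e pE] : exists e, p = (6 * e + 5)%N by exists ((p - 5) %/ 6)%N; arith.
have -> : ((p - 5) %/ 6 = e)%N by arith.
have -> : ((p + 1) %/ 2 = h + 1)%N by arith.
have hE : (h = 3 * e + 2)%N by clear p2; arith.
(* Since 3(4e + 3) = 2p - 1, 4e + 3 is -1/3 modulo p. The monomial is m^(3k - p) n^(5e + 4 - 2k),
   with m^p = m. *)
have H := cubic_sum_hyp (subn (4 * e + 3)) (- 27 / 4) (1 / 12) (7 / 12)
  (fun m n => n ^+ (5 * e + 4) / m) (fun m n => - 4 * m ^+ 3 / (27 * n ^+ 2)).
have {H} := H _ _ _ _ m n m0 n0.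
rewrite (_ : 1 - _ = (4 * m ^+ 3 + 27 * n ^+ 2) / (27 * n ^+ 2)); last by field; rewrite n0.
have fermat (x : F) : x != 0 -> x ^+ (5 * e + 4) = (x ^+ e)^-1.
  move=> x0; apply: (mulIf (x := x ^+ e)); first by rewrite expf_neq0.
  rewrite mulVf ?expf_neq0 // -exprD (_ : 5 * e + 4 + e = p.-1)%N ?Fp_expp1 //; arith.
move=> H; apply: (mulfI (x := 2 ^+ (5 * e + 4) / (- 3))).
  by rewrite mulf_neq0 ?invr_neq0 ?expf_neq0.
rewrite H {H}.
- have h3 : 3 ^+ h = - (-1) ^+ h :> F.
    have := Fp_minus3_power_2mod3 p2; rewrite exprNn => /(canRL (signrMK _)).
    by rewrite mulrN1.
  rewrite h3 !fermat // !expr_div_n exprD expr1; field.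
  by rewrite ?m0 ?expf_neq0 ?N3.
- apply: hyprec_hasse_poly_decr => // [k|].
    have [kK|kK] := ltnP k (4 * e + 3); [left|right]; split=> //; try by arith.
    rewrite natrB 1?ltnW // mulrBr -natrM.
    have -> : (3 * (4 * e + 3))%:R = - 1 :> F.
      apply/eqP; rewrite -addr_eq0 natr1.
      by rewrite (_ : (3 * (4 * e + 3)).+1 = 2 * p)%N ?natrM ?pchar_Fp_0 ?mulr0 //; arith.
    by ring.
  by apply: hasse_coef_out; rewrite /hasse_coef_range; arith.
- move=> G; rewrite (sum_reverse (fun i => (hasse_coef h i)%:R * G i)); last 2 first.
    by rewrite hasse_coef0 mul0r.
    by arith.
  by rewrite hasse_coef_sum_widen //; arith.
- move=> {m0 n0} {}m {}n k m0 n0 _ r.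
  rewrite (_ : - 27 / 4 * _ = m ^+ 3 / n ^+ 2); last by field; rewrite ?F4 ?F27 n0.
  apply: (mulIf (x := m ^+ p * n ^+ (2 * k))); first by rewrite mulf_neq0 ?expf_neq0.
  rewrite [LHS](_ : _ = m ^+ (2 * h - 3 * (4 * e + 3 - k) + p) *
                       n ^+ (2 * (4 * e + 3 - k) - h + 2 * k)); last first.
    by rewrite [in RHS](exprD m _ (p)) [in RHS](exprD n _ (2 * k)) mulrACA.
  rewrite (_ : 2 * h - 3 * (4 * e + 3 - k) + p = 3 * k)%N; last first.
    by move: r; rewrite /hasse_coef_range; arith.
  rewrite (_ : 2 * (4 * e + 3 - k) - h + 2 * k = 5 * e + 4)%N; last first.
    by move: r; rewrite /hasse_coef_range; arith.
  rewrite (_ : m ^+ p = m); last first.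
    by rewrite -[X in _ ^+ X](prednK (prime_gt0 p_prime)) exprS Fp_expp1 // mulr1.
  by rewrite expr_div_n !exprM; field; rewrite !expf_neq0 // m0.
- by field; rewrite (natrM _ 4 27) mulf_neq0.
Qed.

End PrimeField.

(** * Reduction of p-integral rationals modulo p *)

Section Reduction.
Variable p : nat.
Hypothesis p_prime : prime p.
Local Notation F := 'F_p.

(* The residue map from Z_p to F_p, as a relation. *)
Definition reduces (a : rat) (r : F) := exists x y : int,
  [/\ (y%:~R : F) != 0, a = x%:~R / y%:~R & r = x%:~R / y%:~R].

Lemma intr_Fp_eq0 (y : int) : ((y%:~R : F) == 0) = (p %| `|y|)%N.
Proof. by rewrite -(dvdz_pcharf (pchar_Fp p_prime)). Qed.

Lemma intr_Fp_rat_neq0 (y : int) : (y%:~R : F) != 0 -> (y%:~R : rat) != 0.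
Proof. by apply: contraNneq => /eqP; rewrite intr_eq0 => /eqP ->. Qed.

Lemma reduces_int (x : int) : reduces x%:~R x%:~R.
Proof. by exists x, 1; rewrite !divr1 oner_neq0. Qed.

Lemma reduces_nat (x : nat) : reduces x%:R x%:R.
Proof. exact: (reduces_int x). Qed.

Lemma reducesD a b r s : reduces a r -> reduces b s -> reduces (a + b) (r + s).
Proof.
move=> [x [y [y0 -> ->]]] [x' [y' [y0' -> ->]]].
exists (x * y' + x' * y), (y * y'); rewrite !(intrD, intrM); split.
- by rewrite mulf_neq0.
- by field; rewrite !intr_Fp_rat_neq0.
- by field; rewrite y0 y0'.
Qed.

Lemma reducesN a r : reduces a r -> reduces (- a) (- r).
Proof.
by move=> [x [y [y0 -> ->]]]; exists (- x), y; rewrite !mulrNz !mulNr.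
Qed.

Lemma reducesM a b r s : reduces a r -> reduces b s -> reduces (a * b) (r * s).
Proof.
move=> [x [y [y0 -> ->]]] [x' [y' [y0' -> ->]]].
exists (x * x'), (y * y'); rewrite !intrM; split.
- by rewrite mulf_neq0.
- by field; rewrite !intr_Fp_rat_neq0.
- by field; rewrite y0 y0'.
Qed.

Lemma reducesV a r : r != 0 -> reduces a r -> reduces a^-1 r^-1.
Proof.
move=> r0 [x [y [y0 -> rE]]].
exists y, x; split; rewrite ?rE ?invf_div //.
by apply: contraNneq r0 => x0; rewrite rE x0 mul0r.
Qed.

Lemma reducesX a r k : reduces a r -> reduces (a ^+ k) (r ^+ k).
Proof.
move=> ar; elim: k => [|k IH]; first exact: (reduces_nat 1).
by rewrite !exprS; apply: reducesM.
Qed.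

Lemma reduces_sum (I : finType) (f : I -> rat) (g : I -> F) :
  (forall i, reduces (f i) (g i)) -> reduces (\sum_i f i) (\sum_i g i).
Proof.
move=> fg; elim/big_rec2: _ => [|i r a _ ar]; first exact: (reduces_nat 0).
exact: reducesD.
Qed.

Lemma reduces_prod (I : finType) (f : I -> rat) (g : I -> F) :
  (forall i, reduces (f i) (g i)) -> reduces (\prod_i f i) (\prod_i g i).
Proof.
move=> fg; elim/big_rec2: _ => [|i r a _ ar]; first exact: (reduces_nat 1).
exact: reducesM.
Qed.

(** Cross-multiplying the two fractions gives an identity of integers, which is then read in F_p. *)
Lemma reduces_inj a r s : reduces a r -> reduces a s -> r = s.
Proof.
move=> [x [y [y0 aE ->]]] [x' [y' [y0' aE' ->]]].
apply/eqP; rewrite eqr_div // -!intrM; apply/eqP; congr _%:~R.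
apply/eqP; rewrite -(eqr_int rat) !intrM -eqr_div ?intr_Fp_rat_neq0 //.
by rewrite -aE aE'.
Qed.

Lemma reduces_ratr a : pintegral p a -> reduces a (ratr a).
Proof.
move=> ap; exists (numq a), (denq a); rewrite divq_num_den; split=> //.
by rewrite intr_Fp_eq0 -prime_coprime.
Qed.

Lemma ratr_reduces a r : reduces a r -> pintegral p a -> ratr a = r.
Proof. by move=> ar /reduces_ratr /reduces_inj; apply. Qed.

Lemma pintegral_fraction (x y : int) : ~~ (p %| `|y|)%N -> pintegral p (x%:~R / y%:~R).
Proof.
rewrite /pintegral; case: divqP => [_|k a _]; first by rewrite (denq_int 0) coprimen1.
by rewrite prime_coprime // abszM; apply: contra => ?; rewrite dvdn_mull.
Qed.

(** The difference is x / y with residue 0, so p divides x, and dividing by p keeps the denominator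
    y prime to p. *)
Lemma reduces_eqmodp a b r : reduces a r -> reduces b r -> eqmodp p a b.
Proof.
move=> ar br; have := reducesD _ _ _ _ ar (reducesN _ _ br).
rewrite subrr => -[x [y [y0 E r0]]]; rewrite /eqmodp E.
have : (x%:~R : F) == 0.
  by move/eqP: r0; rewrite eq_sym mulf_eq0 invr_eq0 (negPf y0) orbF.
rewrite intr_Fp_eq0 => /dvdnP[c xc].
have [x' ->] : exists x', x = x' * p%:Z.
  have /dvdzP[x' ->] : (p%:Z %| x)%Z by rewrite dvdzE /= xc dvdn_mull.
  by exists x'.
have p0 : (p%:R : rat) != 0 by rewrite pnatr_eq0 -lt0n prime_gt0.
rewrite (_ : _ / _ / _ = x'%:~R / y%:~R); last first.
  by rewrite intrM; field; rewrite p0 intr_Fp_rat_neq0.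
by apply: pintegral_fraction; rewrite -intr_Fp_eq0.
Qed.

End Reduction.

(** * Residues of the Legendre sum and of the hypergeometric sums *)

Section Transfer.
Variable p : nat.
Hypotheses (p_prime : prime p) (p_gt3 : (3 < p)%N).
Local Notation F := 'F_p.
Local Notation reduces := (reduces p).
Let charF : p \in [pchar F] := pchar_Fp p_prime.

Lemma reduces_pintegral a r : reduces a r -> pintegral p a.
Proof. by move=> [x [y [y0 -> _]]]; apply: pintegral_fraction; rewrite // -intr_Fp_eq0. Qed.

(** This is Euler's criterion; at residue 0 both sides are 0 because the exponent is positive. *)
Lemma legendre_reduces a r : reduces a r -> (legendre p a)%:~R = r ^+ (p.-1)./2.
Proof.
move=> ar; rewrite /legendre (ratr_reduces p p_prime a r) ?(reduces_pintegral a r) //.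
case: eqVneq => [->|r0]; first by rewrite expr0n gtn_eqF //; arith.
by rewrite Fp_euler //; case: ifP.
Qed.

Lemma sum_ord_Fp (f : F -> F) : \sum_(x < p) f x%:R = \sum_x f x.
Proof.
have inj : injective (fun x : 'I_p => x%:R : F).
  by move=> x y /(congr1 val) /=; rewrite !val_Fp_nat // !modn_small // => /val_inj.
have bij : bijective (fun x : 'I_p => x%:R : F).
  by apply: inj_card_bij => //; rewrite card_Fp // card_ord.
by rewrite [RHS](reindex _ (onW_bij _ bij)).
Qed.

Lemma binomq_reduces a r k : (k < p)%N -> reduces a r ->
  reduces (binomq a k) ((\prod_(i < k) (r - i%:R)) / (k`!)%:R).
Proof.
move=> kp ar; apply: reducesM => //.
  apply: reduces_prod => // i; apply: reducesD => //; apply: reducesN => //.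
  exact: reduces_nat.
apply: reducesV; last exact: reduces_nat.
exact: fact_pchar_neq0 charF _ kp.
Qed.

Lemma hyp_sum_reduces a b u r s v : reduces a r -> reduces b s -> reduces u v ->
  reduces (\sum_(k < p) binomq a k * binomq b k * u ^+ k)
    (\sum_(k < p) hypcoef F r s k * v ^+ k).
Proof.
move=> ar bs uv; apply: reduces_sum => // k.
apply: reducesM => //; last exact: reducesX.
by apply: reducesM => //; apply: binomq_reduces.
Qed.

Lemma legendre_sum_reduces m n r s : reduces m r -> reduces n s ->
  reduces (\sum_(x < p) legendre p (x%:R ^+ 3 + m * x%:R + n))%:~R (cubic_sum p r s).
Proof.
move=> mr ns; have := reduces_int p (\sum_(x < p) legendre p (x%:R ^+ 3 + m * x%:R + n)).
rewrite [X in reduces _ X -> _]rmorph_sum /= /cubic_sum -sum_ord_Fp.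
under [X in reduces _ X -> _]eq_bigr => x _.
  rewrite (legendre_reduces _ (x%:R ^+ 3 + r * x%:R + s)); last first.
    do ![apply: reducesD => //|apply: reducesM => //|apply: reducesX => //|exact: reduces_nat].
  over.
by [].
Qed.

End Transfer.

(** Follows the syntax of a rational expression, leaving its atoms and the nonvanishing of inverted
    residues. *)
Ltac reduce_rat :=
  lazymatch goal with
  | |- reduces _ (_ + _) _ => apply: reducesD => //; reduce_rat
  | |- reduces _ (- _) _ => apply: reducesN => //; reduce_rat
  | |- reduces _ (_ * _) _ => apply: reducesM => //; reduce_rat
  | |- reduces _ (_ ^-1) _ => apply: reducesV => //; reduce_rat
  | |- reduces _ (_ ^+ _) _ => apply: reducesX => //; reduce_rat
  | |- reduces _ 1 _ => exact: (reduces_nat _ 1)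
  | |- reduces _ (_ %:R) _ => exact: reduces_nat
  | _ => idtac
  end.

Theorem theorem3p2 (p : nat) (m n : rat)
  (p_prime : prime p) (p_gt3 : (3 < p)%N)
  (m_int : pintegral p m) (n_int : pintegral p n)
  (mn_neq0 : ~~ eqmodp p (m * n) 0) :
  let L : rat :=
    (\sum_(x < p) legendre p (x%:R ^+ 3 + m * x%:R + n))%:~R in
  let S1 : rat :=
    \sum_(k < p) binomq (- (1 / 12)) k * binomq (- (5 / 12)) k
       * ((4 * m ^+ 3 + 27 * n ^+ 2) / (4 * m ^+ 3)) ^+ k in
  let S2 : rat :=
    \sum_(k < p) binomq (- (1 / 12)) k * binomq (- (7 / 12)) k
       * ((4 * m ^+ 3 + 27 * n ^+ 2) / (27 * n ^+ 2)) ^+ k in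
  (((4 %| p - 1)%N ->
      eqmodp p L (- (- 3 * m) ^+ ((p - 1) %/ 4) * S1)) /\
   ((4 %| p - 3)%N ->
      eqmodp p L ((2 * m) / (9 * n) * (legendre p (- 3 * m))%:~R
                  * (- 3 * m) ^+ ((p + 1) %/ 4) * S1))) /\
  (((3 %| p - 1)%N ->
      eqmodp p L ((-1) ^+ ((p + 1) %/ 2) * (n / 2) ^+ ((p - 1) %/ 6) * S2)) /\
   ((3 %| p - 2)%N ->
      eqmodp p L ((-1) ^+ ((p + 1) %/ 2) * (3 / m)
                  * (2 / n) ^+ ((p - 5) %/ 6) * S2))).
Proof.
move=> L S1 S2.
have mr := reduces_ratr p p_prime m m_int; have ns := reduces_ratr p p_prime n n_int.
move: (ratr m) (ratr n) mr ns => r s mr ns.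
have /norP[r0 s0] : ~~ ((r == 0) || (s == 0)).
  rewrite -mulf_eq0; apply: contra mn_neq0 => /eqP rs0.
  by apply: (reduces_eqmodp p p_prime _ _ 0 _ (reduces_nat p 0)); rewrite -rs0; apply: reducesM.
have F2 := (natr_Fp_neq0_2_3 p p_prime p_gt3).1.
have F3 := (natr_Fp_neq0_2_3 p p_prime p_gt3).2.
have F4 : 4 != 0 :> 'F_p by rewrite (natrM _ 2 2) mulf_neq0.
have F9 : 9 != 0 :> 'F_p by rewrite (natrM _ 3 3) mulf_neq0.
have F12 : 12 != 0 :> 'F_p by rewrite (natrM _ 3 4) mulf_neq0.
have F27 : 27 != 0 :> 'F_p by rewrite (natrM _ 3 9) mulf_neq0.
have Lr : reduces p L (cubic_sum p r s) by apply: legendre_sum_reduces.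
have S1r : reduces p S1 (\sum_(k < p) hypcoef 'F_p (- (1 / 12)) (- (5 / 12)) k *
    ((4 * r ^+ 3 + 27 * s ^+ 2) / (4 * r ^+ 3)) ^+ k).
  by apply: hyp_sum_reduces => //; reduce_rat; rewrite ?mulf_neq0 ?expf_neq0.
have S2r : reduces p S2 (\sum_(k < p) hypcoef 'F_p (- (1 / 12)) (- (7 / 12)) k *
    ((4 * r ^+ 3 + 27 * s ^+ 2) / (27 * s ^+ 2)) ^+ k).
  by apply: hyp_sum_reduces => //; reduce_rat; rewrite ?mulf_neq0 ?expf_neq0.
have chi : reduces p (legendre p (- 3 * m))%:~R ((- 3 * r) ^+ (p.-1)./2).
  rewrite -(legendre_reduces p p_prime p_gt3 (- 3 * m)); first exact: reduces_int.
  by reduce_rat.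
split; split=> pmod; apply: (reduces_eqmodp p p_prime _ _ _ Lr).
(* The body of [S1] is forgotten so that the sum is an opaque factor with known residue. *)
- rewrite cubic_sum_1mod4 //; move: S1 S1r => S S1r; reduce_rat.
- rewrite cubic_sum_3mod4 //; move: S1 S1r => S S1r; reduce_rat; rewrite ?mulf_neq0 //.
- rewrite cubic_sum_1mod3 //; move: S2 S2r => S S2r; reduce_rat.
- rewrite cubic_sum_2mod3 //; move: S2 S2r => S S2r; reduce_rat.
Qed.
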